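(* Let $n$ be a positive integer, let $p=11$ or $p=13$, and let $R$ be a commutative associative ring with unity. The following statements (1) and (2) are equivalent: (1) Every matrix in $M_n(R)$ is a sum of $p$-th powers of matrices in $M_n(R)$. (2) Every element of $R$ is a $p$-th power modulo $pR$, i.e. for every $r\in R$ there is $a\in R$ with $r-a^p\in pR$. In particular, if $R$ is an order in an algebraic number field, then these conditions are further equivalent to $(p,\operatorname{disc} R)=1$. Also, for $M\in M_n(R)$: $\operatorname{tr}(M)\in\{a_0^p \pmod{pR}\mid a_0\in R\}$ (i.e. there exists $a_0\in R$ with $\operatorname{tr}(M)\equiv a_0^p \pmod{pR}$) if and only if $M$ is a sum of $p$-th powers of matrices in $M_n(R)$.
   Context: $M_n(R)$ is the ring of $n\times n$ matrices over $R$ and $\operatorname{tr}$ is the trace. A ''sum of $k$-th powers of matrices in $M_n(R)$'' means a finite sum $\sum_{i=1}^{l} M_i^k$ with $M_i\in M_n(R)$ (any finite number of terms). An order $R$ in an algebraic number field $K$ is a subring of $K$ containing the identity which is a $\mathbb{Z}$-module of maximal rank $\deg(K/\mathbb{Q})$; $\operatorname{disc} R$ is its discriminant, and $(a,b)$ denotes the greatest common divisor.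
   Formalization: The pair n = 1, p = 13 is excluded, because the equivalence fails there: in R = F_27 every element is a 13th power modulo 13R = R, but sums of 13th powers give only F_3. *)

(* Defs.v *)
From HB Require Import structures.
From mathcomp Require Import all_boot all_order all_algebra all_field.

Set Implicit Arguments.
Unset Strict Implicit.
Unset Printing Implicit Defensive.

Import GRing.Theory.
Local Open Scope ring_scope.

(* The number of summands is not bounded in advance. *)
Definition sum_of_powers (A : pzRingType) (k : nat) (x : A) : Prop :=
  exists s : seq A, x = \sum_(a <- s) a ^+ k.

Definition power_mod (R : comPzRingType) (p : nat) (r : R) : Prop :=
  exists a b : R, r - a ^+ p = p%:R * b.

Definition field_trace (F : fieldType) (L : fieldExtType F) (x : L) : F :=
  \tr (passmx.mxof (vbasis {:L}) (vbasis {:L}) (amull x)).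

(* e is a basis of V as a Z-module; coordinates are finite functions, so that
   their uniqueness needs no extensionality. *)
Definition Zbasis (V : zmodType) (d : nat) (e : d.-tuple V) : Prop :=
  forall v : V,
    exists! c : {ffun 'I_d -> int}, v = \sum_(i < d) tnth e i *~ c i.

Definition degree (K : fieldExtType rat) : nat := \dim {:K}.

(* R, identified with its image under iota, is a subring of K that is a free
   Z-module of rank deg(K/Q). *)
Definition is_order (R : comPzRingType) (K : fieldExtType rat)
    (iota : {rmorphism R -> K}) : Prop :=
  injective iota /\ exists e : (degree K).-tuple R, Zbasis e.

(* det (Tr_{K/Q} (e_i e_j)); when e is a Z-basis of an order, this rational
   is an integer which does not depend on e, so numq only changes its type. *)
Definition disc (R : comPzRingType) (K : fieldExtType rat)
    (iota : {rmorphism R -> K}) (d : nat) (e : d.-tuple R) : int :=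
  numq (\det (\matrix_(i < d, j < d)
                field_trace (iota (tnth e i) * iota (tnth e j)))).

(* Main.v *)
(* Sums of p-th powers have a trace that is a p-th power modulo p, because
   tr(A^p) = tr(A)^p modulo p.  Conversely, rank one idempotents show that
   every matrix of trace zero is a sum of p-th powers, so everything depends
   on the additive group V of the r such that the matrix r E_00 is such a
   sum, and it suffices to prove that V contains p R.  It contains p! R by
   finite differences, and the primes q < p are then cancelled from p! one at
   a time, because R = V + q R: for p = 11 the polynomial X is a combination
   of 11-th powers in F_q[X], and for p = 13 of Dickson polynomials D_13(t,
   d), which are the traces of 13-th powers of 2 x 2 matrices of trace t and
   determinant d (this is where n > 1 is needed).

   For an order, let T be the matrix of the trace form and Phi the matrix of
   x |-> x^p modulo p.  Invariance of the trace form under Frobenius gives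
   Phi T Phi^T = T, so Phi is invertible when T is.  If Phi is invertible, it
   has finite order m, so that multiplications by basis elements satisfy
   A^(p^m) = A modulo p; they are simultaneously diagonalizable over the
   field with p^m elements, and T = L L^T with L invertible. *)
Require Import Defs.
From HB Require Import structures.
From mathcomp Require Import all_boot all_order all_algebra all_fingroup.
From mathcomp Require Import all_field cyclic ring.

Set Implicit Arguments.
Unset Strict Implicit.
Unset Printing Implicit Defensive.

Import GRing.Theory.
Local Open Scope ring_scope.

(** * Congruences modulo m R *)

(** Shaped so that [power_mod p r] unfolds to a congruence of [r] with some [a ^+ p]. *)
Definition eqmod (R : comPzRingType) (m : nat) (x y : R) : Prop :=
  exists b : R, x - y = m%:R * b.

Section EqMod.
Variables (R : comPzRingType) (m : nat).
Implicit Types x y z : R.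

Lemma eqmod_refl x : eqmod m x x.
Proof. by exists 0; rewrite subrr mulr0. Qed.

Lemma eqmod_sym x y : eqmod m x y -> eqmod m y x.
Proof. by case=> b Eb; exists (- b); rewrite mulrN -Eb opprB. Qed.

Lemma eqmod_trans y x z : eqmod m x y -> eqmod m y z -> eqmod m x z.
Proof.
by case=> b Eb [c Ec]; exists (b + c); rewrite mulrDr -Eb -Ec addrA subrK.
Qed.

Lemma eqmodD x y x' y' : eqmod m x y -> eqmod m x' y' ->
  eqmod m (x + x') (y + y').
Proof.
by case=> b Eb [c Ec]; exists (b + c); rewrite mulrDr -Eb -Ec opprD addrACA.
Qed.

Lemma eqmodM x y x' y' : eqmod m x y -> eqmod m x' y' ->
  eqmod m (x * x') (y * y').
Proof.
rewrite /eqmod => -[b /(canRL (subrK y))->] [c /(canRL (subrK y'))->].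
by exists (b * (m%:R * c + y') + y * c); ring.
Qed.

Lemma eqmodMl z x y : eqmod m x y -> eqmod m (z * x) (z * y).
Proof. exact/eqmodM/eqmod_refl. Qed.

Lemma eqmod_sum (I : Type) (r : seq I) (P : pred I) (F G : I -> R) :
  (forall i, P i -> eqmod m (F i) (G i)) ->
  eqmod m (\sum_(i <- r | P i) F i) (\sum_(i <- r | P i) G i).
Proof. by apply: big_ind2; [exact: eqmod_refl | move=> *; exact: eqmodD]. Qed.

Lemma eqmod_sum0 (I : Type) (r : seq I) (P : pred I) (F : I -> R) :
  (forall i, P i -> eqmod m (F i) 0) -> eqmod m (\sum_(i <- r | P i) F i) 0.
Proof. by move=> /(eqmod_sum r); rewrite big1_eq. Qed.

Lemma eqmod_mulrn k x : (m %| k)%N -> eqmod m (x *+ k) 0.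
Proof.
case/dvdnP=> q ->; exists (q%:R * x).
by rewrite subr0 mulrA mulr_natl -mulrnA mulnC mulr_natl.
Qed.

End EqMod.

(** * Traces of p-th powers modulo p *)

(* Orbits of s have 1 or p elements, and F is constant on them. *)
Lemma sum_perm_fixpoints (R : comPzRingType) (T : finType) (s : {perm T})
    (p : nat) (F : T -> R) :
    prime p -> (s ^+ p)%g = 1%g -> (forall x, F (s x) = F x) ->
  eqmod p (\sum_x F x) (\sum_(x | s x == x) F x).
Proof.
move=> p_pr sp1 Fs.
rewrite (bigID (fun x => s x == x)) /= -[X in eqmod _ _ X]addr0.
apply: eqmodD; first exact: eqmod_refl.
rewrite (partition_big (porbit s) (mem (porbits s))) /=; last first.
  by move=> x _; apply: imset_f.
apply: eqmod_sum0 => _ /imsetP[y _ ->].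
have FX k : F ((s ^+ k)%g y) = F y.
  by elim: k => [|k IHk]; rewrite ?expg0 ?perm1 // expgSr permM Fs.
have [sy | sy'] := eqVneq (s y) y.
  rewrite big_pred0; first exact: eqmod_refl.
  move=> x; apply/negP=> /andP[/negP sx /eqP xy]; apply: sx.
  have: x \in porbit s y by rewrite -xy porbit_id.
  case/porbitP=> k ->; apply/eqP; rewrite -permM -expgSr expgS permM.
  by rewrite sy.
have -> : \sum_(x | (s x != x) && (porbit s x == porbit s y)) F x
          = F y *+ #|porbit s y|.
  rewrite -sumr_const; apply: eq_big => [x | x /andP[_ /eqP xy]].
    rewrite eq_porbit_mem andb_idl // => /porbitP[k Ek].
    apply: contra sy' => /eqP sx; apply/eqP/(@perm_inj _ (s ^+ k)%g).
    by rewrite -permM -expgS expgSr permM -Ek.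
  have: x \in porbit s y by rewrite -xy porbit_id.
  by case/porbitP=> k ->.
(* The orbit length divides p and is not 1, since [y] is moved. *)
apply: eqmod_mulrn.
have: (#|porbit s y| %| p)%N.
  apply: dvdn_trans (_ : (#[s]%g %| p)%N); last by rewrite order_dvdn sp1.
  by rewrite porbit.unlock; exact: (dvdn_orbit 'P%act <[s]>%G y).
case/primeP: (p_pr) => _ + Xp => /(_ _ Xp)/orP[/eqP X1 | /eqP-> //].
case/negP: sy'; have /cards1P[z Ez] : #|porbit s y| == 1%N by apply/eqP.
have:= porbit_id s y; have:= mem_porbit s 1 y; rewrite expg1.
by rewrite Ez !inE => /eqP-> /eqP->.
Qed.

(* Rotating a word does not change the trace of its product, so modulo p only
   the constant words survive in the expansion of the power. *)
Lemma cyclic_frobenius (A : pzRingType) (R : comPzRingType)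
    (tau : {additive A -> R}) (p : nat) (I : finType) (B : I -> A) :
    prime p -> (forall x y, tau (x * y) = tau (y * x)) ->
  eqmod p (tau ((\sum_i B i) ^+ p)) (\sum_i tau (B i ^+ p)).
Proof.
case: p => // m p_pr tauC.
pose G (f : {ffun 'I_m.+1 -> I}) := tau (\prod_k B (f k)).
have -> : tau ((\sum_i B i) ^+ m.+1) = \sum_f G f.
  rewrite -raddf_sum; congr (tau _).
  by rewrite -(bigA_distr_bigA (fun=> B)) prodr_const card_ord.
pose rot (f : {ffun 'I_m.+1 -> I}) := [ffun k => f (ordS k)].
have rot_inj : injective rot.
  move=> f g /ffunP fg; apply/ffunP=> k.
  by have:= fg (ord_pred k); rewrite !ffunE ord_predK.
pose s := perm rot_inj.
have sX k f i : (s ^+ k)%g f i = f (iter k (@ordS m.+1) i).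
  elim: k i => [|k IHk] i; first by rewrite expg0 perm1.
  by rewrite expgSr permM permE ffunE IHk iterSr.
have iter_ordS k (i : 'I_m.+1) :
    val (iter k (@ordS m.+1) i) = ((i + k) %% m.+1)%N.
  elim: k => [|k IHk]; first by rewrite addn0 modn_small.
  by rewrite iterS /= IHk -addn1 modnDml addn1 addnS.
have sp1 : (s ^+ m.+1)%g = 1%g.
  apply/permP=> f; apply/ffunP=> i; rewrite sX perm1; congr (f _).
  by apply/val_inj; rewrite iter_ordS modnDr modn_small.
have sG f : G (s f) = G f.
  rewrite /G permE big_ord_recr /= big_ord_recl tauC.
  congr (tau (_ * _)).
    by rewrite ffunE; congr (B (f _)); apply/val_inj; rewrite /= modnn.
  apply: eq_bigr => k _; rewrite ffunE; congr (B (f _)); apply/val_inj.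
  by rewrite /= modn_small // ltnS.
apply: eqmod_trans (sum_perm_fixpoints p_pr sp1 sG) _.
(* A word fixed by rotation is constant, hence determined by its first letter. *)
rewrite (reindex_onto (fun i => [ffun => i]) (fun f => f ord0)) /=; last first.
  move=> f /eqP sf; apply/ffunP=> i; rewrite ffunE.
  have:= sX i f ord0; have -> : (s ^+ i)%g f = f.
    by elim: (val i) => [|k IHk]; rewrite ?expg0 ?perm1 // expgS permM sf IHk.
  by move->; congr (f _); apply/val_inj; rewrite iter_ordS modn_small ?add0n.
rewrite (eq_bigl xpredT) => [|i]; last first.
  by rewrite ffunE eqxx andbT permE; apply/eqP/ffunP=> k; rewrite !ffunE.
rewrite (eq_bigr (fun i => tau (B i ^+ m.+1))); first exact: eqmod_refl.
move=> i _; rewrite /G; congr (tau _).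
by rewrite (eq_bigr (fun=> B i)) ?prodr_const ?card_ord // => k _; rewrite ffunE.
Qed.

Lemma eqmod_exprDn (R : comPzRingType) (p : nat) (I : finType) (a : I -> R) :
  prime p -> eqmod p ((\sum_i a i) ^+ p) (\sum_i a i ^+ p).
Proof.
move=> p_pr; apply: (cyclic_frobenius (tau := idfun)) => // x y.
exact: mulrC.
Qed.

(** Let B_i keep the i-th row of A and be zero elsewhere. Then B_i^2 = A_ii B_i, so tr(B_i^p) =
    A_ii^p, and both sides are congruent to the sum of the A_ii^p. *)
Lemma tr_expr_prime (R : comPzRingType) (n p : nat) (A : 'M[R]_n) :
  prime p -> eqmod p (\tr (A ^+ p)) (\tr A ^+ p).
Proof.
move=> p_pr; pose B i : 'M[R]_n := \matrix_(j, k) (A j k *+ (j == i)).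
have AB : A = \sum_i B i.
  apply/matrixP=> j k; rewrite summxE (bigD1 j) //= mxE eqxx big1 ?addr0 //.
  by move=> i; rewrite eq_sym mxE => /negPf->.
have trB i : \tr (B i) = A i i.
  rewrite /mxtrace (bigD1 i) //= mxE eqxx big1 ?addr0 //.
  by move=> j /negPf ji; rewrite mxE ji.
have B2 i : B i *m B i = A i i *: B i.
  apply/matrixP=> j k; rewrite !mxE (bigD1 i) //= !mxE eqxx big1 ?addr0.
    by case: eqP => [->|]; rewrite ?mul0r ?mulr0n ?mulr0.
  by move=> l /negPf li; rewrite !mxE li mulr0.
have BX i k : B i ^+ k.+1 = A i i ^+ k *: B i.
  elim: k => [|k IHk]; first by rewrite scale1r.
  by rewrite exprS IHk -[_ * _]/(_ *m _) -scalemxAr B2 scalerA -exprSr.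
have trBp i : \tr (B i ^+ p) = A i i ^+ p.
  by case: (p) (prime_gt0 p_pr) => // k _; rewrite BX mxtraceZ trB -exprSr.
apply: (@eqmod_trans _ _ (\sum_i A i i ^+ p)); last first.
  by apply/eqmod_sym/eqmod_exprDn.
have:= @cyclic_frobenius 'M[R]_n R (@mxtrace R n) p _ B p_pr.
rewrite -AB (eq_bigr _ (fun i _ => trBp i)); apply=> x y.
exact: mxtrace_mulC.
Qed.

(** * Dickson polynomials and certificates modulo q *)

(* The trace of the k-th power of a 2 x 2 matrix of trace t and determinant d. *)
Definition dickson (R : pzRingType) (t d : R) (k : nat) : R :=
  (iter k (fun u => (u.2, t * u.2 - d * u.1)) (2, t)).1.

Lemma dicksonSS (R : pzRingType) (t d : R) k :
  dickson t d k.+2 = t * dickson t d k.+1 - d * dickson t d k.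
Proof. by []. Qed.

Lemma dickson_exp (R : pzRingType) (t : R) k : dickson t 0 k.+1 = t ^+ k.+1.
Proof.
by elim: k => // k IHk; rewrite dicksonSS mul0r subr0 IHk -exprS.
Qed.

(* A polynomial over Z/q is the list of its coefficients, constant term first;
   the certificates below are then checked by computation. *)
Section PolyCertificates.
Variable q : nat.
Implicit Types s t d : seq nat.

Fixpoint padd s t : seq nat :=
  match s, t with
  | [::], _ => t
  | _, [::] => s
  | a :: s', b :: t' => ((a + b) %% q)%N :: padd s' t'
  end.

Definition pscale (c : nat) s : seq nat := [seq ((c * a) %% q)%N | a <- s].

Fixpoint pmul s t : seq nat :=
  if s is a :: s' then padd (pscale a t) (0%N :: pmul s' t) else [::].

(** Same recursion as [dickson], with [q.-1] standing for -1 modulo q. *)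
Definition pdickson t d k : seq nat :=
  (iter k (fun u => (u.2, padd (pmul t u.2) (pscale q.-1 (pmul d u.1))))
     ([:: 2%N], t)).1.

Definition pcomb (p : nat) (tbl : seq (nat * (seq nat * seq nat))) : seq nat :=
  foldr (fun e => padd (pscale e.1 (pdickson e.2.1 e.2.2 p))) [::] tbl.

(** Trailing zeros are allowed since the list operations never trim them. *)
Definition is_pX s : bool :=
  if s is a :: b :: s' then [&& a == 0%N, b == 1%N & all (pred1 0%N) s']
  else false.

Variable R : comPzRingType.

Definition peval s (x : R) : R := foldr (fun c r => c%:R + x * r) 0 s.

Lemma eqmod_natr_modn k : eqmod q ((k %% q)%:R : R) k%:R.
Proof.
apply: eqmod_sym; exists (k %/ q)%:R.
by rewrite {1}(divn_eq k q) natrD addrK natrM mulrC.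
Qed.

Lemma peval_add s t x : eqmod q (peval (padd s t) x) (peval s x + peval t x).
Proof.
elim: s t => [|a s IHs] [|b t] /=; rewrite ?add0r ?addr0; try exact: eqmod_refl.
have -> : a%:R + x * peval s x + (b%:R + x * peval t x)
          = (a + b)%:R + x * (peval s x + peval t x) by rewrite natrD; ring.
by apply: eqmodD; [exact: eqmod_natr_modn | exact: eqmodMl].
Qed.

Lemma peval_scale c s x : eqmod q (peval (pscale c s) x) (c%:R * peval s x).
Proof.
elim: s => [|a s IHs] /=; first by rewrite mulr0; exact: eqmod_refl.
have -> : c%:R * (a%:R + x * peval s x) = (c * a)%:R + x * (c%:R * peval s x).
  by rewrite natrM; ring.
by apply: eqmodD; [exact: eqmod_natr_modn | exact: eqmodMl].
Qed.

Lemma peval_mul s t x : eqmod q (peval (pmul s t) x) (peval s x * peval t x).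
Proof.
elim: s => [|a s IHs]; first by rewrite mul0r; exact: eqmod_refl.
apply: eqmod_trans (peval_add _ _ _) _; rewrite /= mulrDl -mulrA add0r.
by apply: eqmodD; [exact: peval_scale | exact: eqmodMl].
Qed.

Hypothesis q_gt0 : (0 < q)%N.

Lemma peval_dickson t d k x :
  eqmod q (peval (pdickson t d k) x) (dickson (peval t x) (peval d x) k).
Proof.
rewrite /pdickson /dickson.
set u := iter k _ _; set v := iter k _ _.
suff [] : eqmod q (peval u.1 x) v.1 /\ eqmod q (peval u.2 x) v.2 by [].
rewrite {}/u {}/v; elim: k => [|k [IH1 IH2]] /=.
  by rewrite mulr0 addr0; split; exact: eqmod_refl.
split=> //; apply: eqmod_trans (peval_add _ _ _) _; apply: eqmodD.
  by apply: eqmod_trans (peval_mul _ _ _) _; exact: eqmodMl.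
apply: eqmod_trans (peval_scale _ _ _) _; rewrite -mulN1r; apply: eqmodM.
  by exists 1; rewrite opprK natr1 prednK // mulr1.
by apply: eqmod_trans (peval_mul _ _ _) _; exact: eqmodMl.
Qed.

Lemma peval_comb p tbl x :
  eqmod q (peval (pcomb p tbl) x)
    (\sum_(e <- tbl) e.1%:R * dickson (peval e.2.1 x) (peval e.2.2 x) p).
Proof.
elim: tbl => [|e tbl IH]; first by rewrite big_nil; exact: eqmod_refl.
rewrite big_cons; apply: eqmod_trans (peval_add _ _ _) _; apply: eqmodD => //.
apply: eqmod_trans (peval_scale _ _ _) _; apply: eqmodMl; exact: peval_dickson.
Qed.

Lemma peval_pX s x : is_pX s -> peval s x = x.
Proof.
case: s => [|a [|b s]] //= /and3P[/eqP-> /eqP-> s0].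
have -> : peval s x = 0.
  by elim: s s0 => //= c s IHs /andP[/eqP-> /IHs->]; rewrite mulr0 addr0.
by rewrite mulr0 addr0 add0r mulr1.
Qed.

End PolyCertificates.

(** * Tables that express X modulo small primes *)

(* An entry (c, t) stands for c t^11, and the sum over the table is X in F_q[X];
   the tables come from linear algebra over F_q. *)
Definition powers11_mod2 : seq (nat * seq nat) :=
  [:: (1, [:: 1; 0; 1]); (1, [:: 1; 0; 0; 0; 1]);
      (1, [:: 1; 0; 0; 0; 0; 1; 0; 1]); (1, [:: 0; 1; 0; 0; 0; 1]);
      (1, [:: 0; 1; 1; 0; 1]); (1, [:: 0; 1; 1; 1]);
      (1, [:: 1; 0; 0; 0; 0; 0; 1; 1]); (1, [:: 1; 0; 0; 1; 0; 0; 1]);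
      (1, [:: 1; 0; 0; 0; 1; 1; 1]); (1, [:: 0; 0; 0; 1; 0; 1; 0; 1]);
      (1, [:: 0; 1; 0; 0; 0; 1; 1]); (1, [:: 1; 0; 0; 0; 1; 0; 0; 1]);
      (1, [:: 0; 1; 1; 1; 0; 0; 0; 1]); (1, [:: 0; 1; 0; 1; 0; 0; 1]);
      (1, [:: 0; 0; 0; 0; 0; 1]); (1, [:: 1; 1; 1]);
      (1, [:: 1; 0; 0; 1; 1; 0; 0; 1]); (1, [:: 1; 0; 1; 0; 1]);
      (1, [:: 0; 1; 0; 1; 0; 0; 1; 1]); (1, [:: 0; 0; 1; 1; 1]);
      (1, [:: 0; 0; 0; 0; 0; 0; 1]); (1, [:: 0; 0; 1; 0; 1; 1]);
      (1, [:: 1; 0; 0; 0; 0; 1]); (1, [:: 1; 0; 0; 1; 1; 0; 1]);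
      (1, [:: 0; 1; 1; 0; 0; 0; 0; 1]); (1, [:: 0; 1; 0; 1; 1])]%N.

Definition powers11_mod3 : seq (nat * seq nat) :=
  [:: (1, [:: 1; 1]); (2, [:: 1]); (1, [:: 2; 1]); (2, [:: 1; 0; 0; 0; 1; 1]);
      (1, [:: 1; 0; 0; 0; 1]); (1, [:: 0; 1]); (1, [:: 1; 0; 0; 0; 0; 1]);
      (1, [:: 0; 0; 2; 0; 0; 1]); (1, [:: 0; 0; 1]); (1, [:: 0; 0; 1; 1; 1]);
      (2, [:: 0; 0; 1; 1]); (2, [:: 0; 0; 1; 0; 1]); (2, [:: 0; 0; 0; 1]);
      (2, [:: 0; 0; 0; 1; 1]); (1, [:: 0; 0; 1; 0; 0; 1]);
      (1, [:: 0; 0; 0; 0; 1; 1])]%N.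

Definition powers11_mod5 : seq (nat * seq nat) :=
  [:: (4, [:: 1; 1]); (2, [:: 1; 0; 0; 0; 0; 1]); (3, [:: 2; 1]);
      (1, [:: 0; 1]); (2, [:: 1; 0; 1; 1]); (3, [:: 1; 0; 1]);
      (3, [:: 1; 0; 0; 1]); (4, [:: 0; 1; 0; 1]); (1, [:: 0; 2; 1]);
      (1, [:: 0; 1; 1]); (3, [:: 0; 0; 1; 1]); (3, [:: 0; 2; 0; 1]);
      (4, [:: 2; 0; 0; 0; 0; 1]); (4, [:: 0; 0; 0; 0; 0; 1])]%N.

Definition powers11_mod7 : seq (nat * seq nat) :=
  [:: (2, [:: 4; 1]); (1, [:: 1; 2; 1]); (6, [:: 3; 1]); (2, [:: 4; 4; 1]);
      (2, [:: 0; 1]); (6, [:: 1; 1]); (5, [:: 1; 5; 1]); (5, [:: 2; 1]);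
      (6, [:: 0; 0; 1])]%N.

(* An entry (c, (t, d)) stands for c D_13(t, d). *)
Definition dickson13_mod2 : seq (nat * (seq nat * seq nat)) :=
  [:: (1, ([:: 0; 1], [:: 1])); (1, ([:: 1], [:: 0; 0; 0; 1]));
      (1, ([:: 1], [:: 0; 1; 1])); (1, ([:: 1], [:: 0; 1; 0; 1]));
      (1, ([:: 0; 1], [:: 0; 1; 0; 1])); (1, ([:: 1], [:: 1; 0; 1]));
      (1, ([:: 1], [:: 0; 0; 1; 1])); (1, ([:: 1], [:: 1; 0; 0; 1]));
      (1, ([:: 0; 1], [:: 0; 0; 1; 1]))]%N.

Definition dickson13_mod3 : seq (nat * (seq nat * seq nat)) :=
  [:: (1, ([:: 1], [:: 0; 1])); (2, ([:: 1], [:: 0; 2]));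
      (1, ([:: 1], [:: 1; 2])); (2, ([:: 1], [:: 1; 1]))]%N.

Definition dickson13_mod5 : seq (nat * (seq nat * seq nat)) :=
  [:: (4, ([:: 1], [:: 0; 1])); (4, ([:: 1], [:: 0; 2]));
      (4, ([:: 2], [:: 0; 1])); (3, ([:: 1], [:: 1; 2]));
      (3, ([:: 1], [:: 1; 1])); (3, ([:: 1], [:: 0; 3]))]%N.

Definition dickson13_mod7 : seq (nat * (seq nat * seq nat)) :=
  [:: (5, ([:: 1], [:: 0; 1])); (6, ([:: 1], [:: 0; 2]));
      (5, ([:: 2], [:: 0; 2]))]%N.

Definition dickson13_mod11 : seq (nat * (seq nat * seq nat)) :=
  [:: (8, ([:: 1], [:: 0; 1])); (7, ([:: 1], [::])); (1, ([:: 1], [:: 0; 2]));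
      (6, ([:: 2], [:: 0; 1])); (7, ([:: 2], [:: 0; 2]));
      (10, ([:: 3], [:: 0; 1])); (6, ([:: 1], [:: 0; 4]))]%N.

(** * Descent from p! R to p R *)

Section Descent.
Variables (R : comPzRingType) (V : R -> Prop).
Hypothesis V0 : V 0.
Hypothesis VD : forall x y, V x -> V y -> V (x + y).
Hypothesis VN : forall x, V x -> V (- x).

Lemma closed_natmul k x : V x -> V (k%:R * x).
Proof.
move=> Vx; elim: k => [|k IHk]; first by rewrite mul0r.
by rewrite -natr1 mulrDl mul1r; exact: VD.
Qed.

(* Every x is congruent modulo q to an element of V, so if V contains q m R
   then it contains m R. *)
Lemma certificate_descent q p tbl k m : (0 < q)%N -> is_pX (pcomb q p tbl) ->
    (forall e x, e \in tbl ->
       V (dickson (peval e.2.1 x) (peval e.2.2 x) p)) ->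
  (forall x, V ((q ^ k * m)%:R * x)) -> forall x, V (m%:R * x).
Proof.
move=> q_gt0 tbl_ok Vtbl; elim: k => [|k IHk]; first by rewrite mul1n.
move=> Vq; apply: IHk => x; set c := (q ^ k * m)%N.
have [y] := peval_comb q_gt0 p tbl x.
rewrite (peval_pX _ tbl_ok) => /(canRL (subrK _))->.
rewrite mulrDr addrC; apply: VD.
  apply: closed_natmul; rewrite big_seq; elim/big_ind: _ => // e e_tbl.
  exact/closed_natmul/Vtbl.
by rewrite mulrA -natrM mulnC mulnA -expnS.
Qed.

Lemma closed_powers11 : (forall x, V (x ^+ 11)) -> forall x, V (11%:R * x).
Proof.
move=> VX.
(* The empty list means d = 0, where the Dickson polynomial is the plain power. *)
have descent q k m tbl : (0 < q)%N ->
    is_pX (pcomb q 11 [seq (e.1, (e.2, [::])) | e <- tbl]) ->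
  (forall x, V ((q ^ k * m)%:R * x)) -> forall x, V (m%:R * x).
  move=> q_gt0 tbl_ok; apply: certificate_descent tbl_ok _ => // e x.
  by case/mapP=> e' _ -> /=; rewrite dickson_exp.
(* The exponents are those of 11! = 2^8 3^4 5^2 7 11. *)
apply: (@descent 7%N 1%N _ powers11_mod7) => //.
apply: (@descent 5%N 2%N _ powers11_mod5) => //.
apply: (@descent 3%N 4%N _ powers11_mod3) => //.
apply: (@descent 2%N 8%N _ powers11_mod2) => // x.
(* The tenth finite difference of X^11 is 11! (X + 5); copies of 1^11 remove the constant. *)
have -> : (2 ^ 8 * (3 ^ 4 * (5 ^ 2 * (7 ^ 1 * 11))))%:R * x =
    (x + 10) ^+ 11 - 10 * (x + 9) ^+ 11 + 45 * (x + 8) ^+ 11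
    - 120 * (x + 7) ^+ 11 + 210 * (x + 6) ^+ 11 - 252 * (x + 5) ^+ 11
    + 210 * (x + 4) ^+ 11 - 120 * (x + 3) ^+ 11 + 45 * (x + 2) ^+ 11
    - 10 * (x + 1) ^+ 11 + x ^+ 11
    - (5 * (2 ^ 8 * (3 ^ 4 * (5 ^ 2 * (7 ^ 1 * 11)))))%:R * 1 ^+ 11.
  ring.
by do ![exact: VX | exact: closed_natmul | apply: VD | apply: VN].
Qed.

(** Powers alone give no certificate modulo 3: in the field with 27 elements the 13-th powers are 0,
    1 and -1, so their combinations stay in the prime field. *)
Lemma closed_dickson13 :
  (forall t d, V (dickson t d 13)) -> forall x, V (13%:R * x).
Proof.
move=> VDk; have VX x : V (x ^+ 13) by rewrite -dickson_exp.
have descent q k m tbl : (0 < q)%N -> is_pX (pcomb q 13 tbl) ->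
  (forall x, V ((q ^ k * m)%:R * x)) -> forall x, V (m%:R * x).
  by move=> q_gt0 tbl_ok; apply: certificate_descent tbl_ok _.
apply: (@descent 11%N 1%N _ dickson13_mod11) => //.
apply: (@descent 7%N 1%N _ dickson13_mod7) => //.
apply: (@descent 5%N 2%N _ dickson13_mod5) => //.
apply: (@descent 3%N 5%N _ dickson13_mod3) => //.
apply: (@descent 2%N 10%N _ dickson13_mod2) => // x.
(* The twelfth finite difference of X^13 is 13! (X + 6). *)
have -> : (2 ^ 10 * (3 ^ 5 * (5 ^ 2 * (7 ^ 1 * (11 ^ 1 * 13)))))%:R * x =
    (x + 12) ^+ 13 - 12 * (x + 11) ^+ 13 + 66 * (x + 10) ^+ 13
    - 220 * (x + 9) ^+ 13 + 495 * (x + 8) ^+ 13 - 792 * (x + 7) ^+ 13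
    + 924 * (x + 6) ^+ 13 - 792 * (x + 5) ^+ 13 + 495 * (x + 4) ^+ 13
    - 220 * (x + 3) ^+ 13 + 66 * (x + 2) ^+ 13 - 12 * (x + 1) ^+ 13 + x ^+ 13
    - (6 * (2 ^ 10 * (3 ^ 5 * (5 ^ 2 * (7 ^ 1 * (11 ^ 1 * 13))))))%:R * 1 ^+ 13.
  ring.
by do ![exact: VX | exact: closed_natmul | apply: VD | apply: VN].
Qed.

End Descent.

(** * Closure properties of sums of k-th powers *)

Section SumOfPowers.
Variables (A : pzRingType) (k : nat).
Implicit Types x y : A.

Lemma sum_of_powers0 : sum_of_powers k (0 : A).
Proof. by exists [::]; rewrite big_nil. Qed.

Lemma sum_of_powersD x y :
  sum_of_powers k x -> sum_of_powers k y -> sum_of_powers k (x + y).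
Proof. by case=> s -> [t ->]; exists (s ++ t); rewrite big_cat. Qed.

Lemma sum_of_powersX x : sum_of_powers k (x ^+ k).
Proof. by exists [:: x]; rewrite big_seq1. Qed.

Lemma sum_of_powersN x : odd k -> sum_of_powers k x -> sum_of_powers k (- x).
Proof.
move=> k_odd [s ->]; exists [seq - a | a <- s]; rewrite big_map -sumrN.
by apply: eq_bigr => a _; rewrite exprNn -signr_odd k_odd mulN1r.
Qed.

Lemma sum_of_powersB x y : odd k ->
  sum_of_powers k x -> sum_of_powers k y -> sum_of_powers k (x - y).
Proof. by move=> k_odd kx ky; apply/sum_of_powersD/sum_of_powersN. Qed.

Lemma sum_of_powers_sum (I : Type) (r : seq I) (P : pred I) (F : I -> A) :
  (forall i, P i -> sum_of_powers k (F i)) ->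
  sum_of_powers k (\sum_(i <- r | P i) F i).
Proof.
by move=> kF; elim/big_ind: _ => //;
  [exact: sum_of_powers0 | exact: sum_of_powersD].
Qed.

Lemma sum_of_powers_idem x : (0 < k)%N -> x * x = x -> sum_of_powers k x.
Proof.
move=> k_gt0 xx; suff <- : x ^+ k = x by exact: sum_of_powersX.
by case: k k_gt0 => // j _; elim: j => // j IHj; rewrite exprS IHj.
Qed.

End SumOfPowers.

(** * Reduction of a matrix to its trace, for odd k *)

Section MatrixPowers.
Variables (R : comPzRingType) (k : nat).
Hypothesis k_odd : odd k.

Let k_gt0 : (0 < k)%N. Proof. exact: odd_gt0. Qed.

(** From u (v u) v = u v, the product is idempotent. *)
Lemma sum_of_powers_rank1 n (u : 'cV[R]_n) (v : 'rV[R]_n) :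
  v *m u = 1%:M -> sum_of_powers k (u *m v).
Proof.
move=> vu; apply: sum_of_powers_idem => //.
by rewrite -[_ * _]/(_ *m _) mulmxA -(mulmxA u) vu mulmx1.
Qed.

(** E_ii + s E_ij is idempotent for every s; the cases s = r and s = 0 differ by r E_ij. *)
Lemma sum_of_powers_offdiag n (i j : 'I_n) (r : R) :
  i != j -> sum_of_powers k (r *: delta_mx i j : 'M[R]_n).
Proof.
move=> ij.
have idem s : sum_of_powers k (delta_mx i i + s *: delta_mx i j : 'M[R]_n).
  have -> : delta_mx i i + s *: delta_mx i j
            = delta_mx i (0 : 'I_1) *m (delta_mx 0 i + s *: delta_mx 0 j).
    by rewrite mulmxDr -scalemxAr !mul_delta_mx.
  apply: sum_of_powers_rank1.
  rewrite mulmxDl -scalemxAl mul_delta_mx mul_delta_mx_0 1?eq_sym //.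
  by rewrite scaler0 addr0; apply/matrixP=> a b; rewrite !ord1 !mxE.
have -> : r *: delta_mx i j = delta_mx i i + r *: delta_mx i j
                              - (delta_mx i i + 0 *: delta_mx i j) :> 'M[R]_n.
  by rewrite scale0r addr0 addrC addKr.
exact: sum_of_powersB.
Qed.

Lemma sum_of_powers_diag n (i j : 'I_n) (r : R) :
  sum_of_powers k (r *: (delta_mx i i - delta_mx j j) : 'M[R]_n).
Proof.
have [-> | ij] := eqVneq i j.
  by rewrite subrr scaler0; exact: sum_of_powers0.
have ji : j != i by rewrite eq_sym.
pose u : 'cV[R]_n := delta_mx i 0 + delta_mx j 0.
pose v s : 'rV[R]_n := s *: delta_mx 0 i + (1 - s) *: delta_mx 0 j.
(* Here v_s u = s + (1 - s) = 1, and u v_r - u v_0 is r (E_ii - E_jj) up to off-diagonal terms. *)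
have idem s : sum_of_powers k (u *m v s).
  apply: sum_of_powers_rank1.
  rewrite mulmxDl !mulmxDr -!scalemxAl !mul_delta_mx !mul_delta_mx_0 //.
  rewrite !scaler0 addr0 add0r -scalerDl addrC subrK scale1r.
  by apply/matrixP=> a b; rewrite !ord1 !mxE.
have -> : r *: (delta_mx i i - delta_mx j j) =
    u *m v r - u *m v 0 + r *: delta_mx i j - r *: delta_mx j i :> 'M[R]_n.
  rewrite /u /v !mulmxDl !mulmxDr -!scalemxAr !mul_delta_mx.
  apply/matrixP=> a b; rewrite !mxE; ring.
apply: sum_of_powersB => //; last exact: sum_of_powers_offdiag.
by apply: sum_of_powersD; [exact: sum_of_powersB | exact: sum_of_powers_offdiag].
Qed.

(** The two matrices differ by one of trace zero, which is a combination of the matrices E_ij and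
    E_ii - E_jj treated above. *)
Lemma sum_of_powers_tr n (M : 'M[R]_n) (i0 : 'I_n) :
  sum_of_powers k M <-> sum_of_powers k (\tr M *: delta_mx i0 i0 : 'M[R]_n).
Proof.
have kM : sum_of_powers k (M - \tr M *: delta_mx i0 i0).
  have -> : M - \tr M *: delta_mx i0 i0
      = \sum_i (M i i *: (delta_mx i i - delta_mx i0 i0)
                + \sum_(j | j != i) M i j *: delta_mx i j).
    rewrite {1}[M]matrix_sum_delta big_split /=.
    rewrite (eq_bigr (fun i => M i i *: delta_mx i i
                      + \sum_(j | j != i) M i j *: delta_mx i j)); last first.
      by move=> i _; rewrite (bigD1 i).
    rewrite big_split /= addrAC; congr (_ + _).
    rewrite scaler_suml -sumrB.
    by apply: eq_bigr => i _; rewrite scalerBr.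
  apply: sum_of_powers_sum => i _; apply: sum_of_powersD.
    exact: sum_of_powers_diag.
  apply: sum_of_powers_sum => j ji.
  by apply: sum_of_powers_offdiag; rewrite eq_sym.
split=> kx; last first.
  by rewrite -(subrK (\tr M *: delta_mx i0 i0) M); exact: sum_of_powersD.
rewrite -[_ *: _](subKr M); exact: sum_of_powersB.
Qed.

Lemma expr_scale_delta n (i : 'I_n) (x : R) m :
  (x *: delta_mx i i) ^+ m.+1 = x ^+ m.+1 *: delta_mx i i :> 'M[R]_n.
Proof.
elim: m => [|m IHm]; first by rewrite !expr1.
rewrite exprS IHm -[_ * _]/(_ *m _) -scalemxAl -scalemxAr scalerA -exprS.
by rewrite mul_delta_mx.
Qed.

Lemma mxtrace_delta n (i j : 'I_n) :
  \tr (delta_mx i j : 'M[R]_n) = (i == j)%:R.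
Proof.
rewrite /mxtrace (bigD1 i) //= mxE eqxx big1 ?addr0 // => l /negPf li.
by rewrite mxE li.
Qed.

(** [E] plays the identity of a 2 x 2 block containing [B], and the last hypothesis is
    Cayley-Hamilton there; multiplied by a power of [B], it gives the Dickson recursion. The
    exponent is positive because B^0 has trace n instead of 2. *)
Lemma tr_expr_dickson n (B E : 'M[R]_n) (t d : R) j :
    \tr B = t -> \tr E = 2 -> B *m E = B -> B *m B = t *: B - d *: E ->
  \tr (B ^+ j.+1) = dickson t d j.+1.
Proof.
move=> trB trE BE BB.
suff [] : \tr (B ^+ j.+1) = dickson t d j.+1 /\
          \tr (B ^+ j.+2) = dickson t d j.+2 by [].
have B2 : \tr (B ^+ 2) = dickson t d 2.
  by rewrite expr2 -[_ * _]/(_ *m _) BB linearB /= !mxtraceZ trB trE.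
elim: j => [|j [IH1 IH2]]; first by rewrite expr1.
split=> //; rewrite dicksonSS -IH1 -IH2 -!mxtraceZ -linearB /=; congr (\tr _).
have -> : B ^+ j.+3 = B ^+ j.+1 *m (B *m B).
  by rewrite -[RHS]/(_ * (B * B)) mulrA -!exprSr.
rewrite BB mulmxBr -!scalemxAr -[B ^+ j.+1 *m B]/(_ * B) -exprSr.
by congr (_ - _ *: _); rewrite exprSr -[_ * B]/(_ *m B) -mulmxA BE.
Qed.

End MatrixPowers.

(** * The trace criterion for p = 11 and p = 13 *)

Lemma sum_of_powers_multiple (R : comPzRingType) (n p : nat) (r : R)
    (i : 'I_n) : p = 11%N \/ p = 13%N -> (n, p) <> (1, 13)%N ->
  sum_of_powers p ((p%:R * r) *: delta_mx i i : 'M[R]_n).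
Proof.
move=> hp hnp; have p_odd : odd p by case: hp => ->.
pose V x := sum_of_powers p (x *: delta_mx i i : 'M[R]_n).
have V0 : V 0 by rewrite /V scale0r; exact: sum_of_powers0.
have VD x y : V x -> V y -> V (x + y).
  by rewrite /V scalerDl; exact: sum_of_powersD.
have VN x : V x -> V (- x) by rewrite /V scaleNr; exact: sum_of_powersN.
rewrite -/(V _); move: r; case: hp => Ep.
  rewrite {1}Ep; apply: (closed_powers11 V0 VD VN) => x; rewrite /V Ep.
  rewrite -expr_scale_delta; exact: sum_of_powersX.
(* For p = 13 the excluded pair forces n > 1, which leaves room for a 2 x 2 block. *)
have [j ji] : exists j : 'I_n, j != i.
  have [n1 | /card_gt0P[j ji]] := posnP #|[pred j : 'I_n | j != i]|.
    case: hnp; congr (_, _) => //.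
    have n_gt0 : (0 < n)%N by exact: leq_ltn_trans (ltn_ord i).
    rewrite -(prednK n_gt0); have:= cardC1 i; rewrite card_ord => <-.
    by rewrite n1.
  by exists j.
rewrite {1}Ep; apply: (closed_dickson13 V0 VD VN) => t d; rewrite /V.
(* [B] is the companion matrix of X^2 - t X + d on the indices [i] and [j]. *)
pose B : 'M[R]_n := t *: delta_mx i i - d *: delta_mx i j + delta_mx j i.
pose E : 'M[R]_n := delta_mx i i + delta_mx j j.
have ij : i != j by rewrite eq_sym.
rewrite -(@tr_expr_dickson _ n B E) -?Ep; first 1 last.
- rewrite /B !linearD linearN /= !mxtraceZ !mxtrace_delta eqxx (negPf ij).
  by rewrite (negPf ji) mulr1 mulr0 subr0 addr0.
- by rewrite /E linearD /= !mxtrace_delta !eqxx.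
- rewrite /B /E !mulmxDr !mulmxDl !mulNmx -!scalemxAl !mul_delta_mx_cond eqxx.
  rewrite eqxx (negPf ij) (negPf ji) !mulr1n !mulr0n !scaler0.
  by apply/matrixP=> a b; rewrite !mxE; ring.
- rewrite /B /E.
  do !rewrite ?mulmxDr ?mulmxDl ?mulNmx ?mulmxN -?scalemxAl -?scalemxAr.
  rewrite !mul_delta_mx_cond !eqxx (negPf ij) (negPf ji) !mulr1n !mulr0n.
  by apply/matrixP=> a b; rewrite !mxE; ring.
by apply: (proj1 (sum_of_powers_tr p_odd _ _)); exact: sum_of_powersX.
Qed.

(** Modulo p, tr(A^p) is (tr A)^p, and p-th powers add up; the witness is the sum of the traces. *)
Lemma power_mod_tr (R : comPzRingType) (n p : nat) (M : 'M[R]_n) :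
  prime p -> sum_of_powers p M -> power_mod p (\tr M).
Proof.
move=> p_pr [s ->]; exists (\sum_(A <- s) \tr A).
rewrite linear_sum /= -/(eqmod p _ _).
apply: (@eqmod_trans _ _ (\sum_(A <- s) \tr A ^+ p)).
  by apply: eqmod_sum => A _; exact: tr_expr_prime.
rewrite [X in eqmod _ X _](big_nth 0) [X in eqmod _ _ (X ^+ _)](big_nth 0).
by rewrite !big_mkord; exact/eqmod_sym/eqmod_exprDn.
Qed.

Lemma sum_of_powers_power_mod (R : comPzRingType) (n p : nat) (M : 'M[R]_n) :
    (0 < n)%N -> p = 11%N \/ p = 13%N -> (n, p) <> (1, 13)%N ->
  power_mod p (\tr M) <-> sum_of_powers p M.
Proof.
move=> n_gt0 hp hnp; have p_odd : odd p by case: hp => ->.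
have p_pr : prime p by case: hp => ->.
split; last exact: power_mod_tr.
case=> a [b /(canRL (subrK _)) trM]; pose i := Ordinal n_gt0.
(* With tr M = p b + a^p, the second part is a^p E_ii = (a E_ii)^p. *)
apply/(sum_of_powers_tr p_odd M i); rewrite trM scalerDl.
apply: sum_of_powersD; first exact: sum_of_powers_multiple.
rewrite -(prednK (prime_gt0 p_pr)) -expr_scale_delta; exact: sum_of_powersX.
Qed.

(** * Trace forms of commuting matrices over a finite field *)

Lemma unitmx_finite_order (F : finFieldType) n (A : 'M[F]_n) :
  A \in unitmx -> exists2 m, (0 < m)%N & A ^+ m = 1%:M.
Proof.
case: n A => [|n] A A_unit; first by exists 1%N => //; apply/matrixP=> -[].
pose g : {unit 'M[F]_n.+1} := FinRing.Unit A_unit.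
exists #[g]%g; first exact: order_gt0.
by rewrite -[A]/(val g) -FinRing.val_unitX expg_order.
Qed.

(* The A_i are simultaneously diagonalizable, with diagonals the rows of an
   invertible matrix L, and the matrix below is L L^T. *)
Lemma trace_form_unit (F : finFieldType) n (A : 'I_n -> 'M[F]_n) :
    (forall i j, A i *m A j = A j *m A i) -> (forall i, A i ^+ #|F| = A i) ->
    (forall c : 'rV[F]_n, \sum_i c 0 i *: A i = 0 -> c = 0) ->
  \matrix_(i, j) \tr (A i *m A j) \in unitmx.
Proof.
case: n A => [|n] A AC AX A_free.
  by rewrite unitmxE det_mx00 unitr1.
(* A_i is a root of X^|F| - X, a product of distinct linear factors over F. *)
have A_diag i : diagonalizable (A i).
  apply/diagonalizableP; exists (enum F); first exact: enum_uniq.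
  rewrite big_enum -finField_genPoly; apply: mxminpoly_min.
  by rewrite rmorphB rmorphXn /= horner_mx_X AX subrr.
have [P P_unit /allP PA] : codiagonalizable [seq A i | i <- enum 'I_n.+1].
  apply/codiagonalizableP; split=> [_ _ /mapP[i _ ->] /mapP[j _ ->] |].
    exact: AC.
  by move=> _ /mapP[i _ ->]; exact: A_diag.
have [D DE] : exists D : _ -> 'M[F]_n.+1, forall i, D i = P *m A i *m invmx P.
  by eexists.
have D_diag i : is_diag_mx (D i).
  have /PA : A i \in [seq A i | i <- enum 'I_n.+1] by rewrite map_f ?mem_enum.
  by rewrite /= -[X in is_true X]/(is_diag_mx (conjmx P (A i))) conjumx // DE.
pose L : 'M[F]_n.+1 := \matrix_(i, k) D i k k.
have -> : \matrix_(i, j) \tr (A i *m A j) = L *m L^T.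
  apply/matrixP=> i j; rewrite !mxE.
  have -> : \tr (A i *m A j) = \tr (D i *m D j).
    by rewrite !DE !mulmxA mulmxKV // [RHS]mxtrace_mulC !mulmxA mulVmx // mul1mx.
  apply: eq_bigr => k _; rewrite !mxE (bigD1 k) //= big1 ?addr0 // => l lk.
  have /is_diag_mxP/(_ k l) -> := D_diag i; first by rewrite mul0r.
  by rewrite eq_sym.
(* A relation between the rows of [L] is one between the diagonal D_i, hence between the A_i. *)
rewrite unitmx_mul unitmx_tr andbb -row_free_unit.
apply/inj_row_free => c cL; apply: A_free.
have {cL} : \sum_i c 0 i *: D i = 0.
  apply/matrixP=> k l; rewrite summxE mxE.
  have [-> | kl] := eqVneq k l; last first.
    apply: big1 => i _; have /is_diag_mxP/(_ k l kl) := D_diag i.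
    by rewrite mxE => ->; rewrite mulr0.
  apply: (etrans (y := (c *m L) 0 l)); last by rewrite cL mxE.
  rewrite [RHS]mxE.
  by apply: eq_bigr => i _; rewrite !mxE.
have -> : \sum_i c 0 i *: D i = P *m (\sum_i c 0 i *: A i) *m invmx P.
  rewrite mulmx_sumr mulmx_suml; under eq_bigr do rewrite DE.
  apply: eq_bigr => i _.
  by rewrite -scalemxAr -scalemxAl.
move/(congr1 (fun M => invmx P *m M *m P)).
by rewrite mulmxA mulKmx ?mulmxKV // mulmx0 mul0mx.
Qed.

(** * Integer coordinates and the regular representation *)

Section OrderBasis.
Variables (R : comPzRingType) (d : nat) (e : d.-tuple R).
Hypothesis e_basis : Zbasis e.

Definition zcomb (v : 'rV[int]_d) : R := \sum_i tnth e i *~ v 0 i.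

Lemma zcoords_subproof (r : R) : exists v, r == zcomb v.
Proof.
have [c [rc _]] := e_basis r; exists (\row_i c i); rewrite {1}rc; apply/eqP.
by apply: eq_bigr => i _; rewrite mxE.
Qed.

Definition zcoords (r : R) : 'rV[int]_d := xchoose (zcoords_subproof r).

Lemma zcoordsK : cancel zcoords zcomb.
Proof. by move=> r; rewrite -(eqP (xchooseP (zcoords_subproof r))). Qed.

Lemma zcombK : cancel zcomb zcoords.
Proof.
move=> v; have [c [_ c_uniq]] := e_basis (zcomb v).
have cP w : zcomb v = zcomb w -> w = \row_i c i.
  move=> vw; have <- : [ffun i => w 0 i] = c.
    apply/esym/c_uniq; rewrite vw.
    by apply: eq_bigr => i _; rewrite ffunE.
  by apply/rowP=> i; rewrite mxE ffunE.
by rewrite [RHS]cP //; apply: cP; rewrite zcoordsK.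
Qed.

Fact zcomb_is_additive : zmod_morphism zcomb.
Proof.
move=> v w; rewrite /zcomb -sumrB.
by apply: eq_bigr => i _; rewrite !mxE mulrzBr.
Qed.
HB.instance Definition _ :=
  GRing.isZmodMorphism.Build 'rV[int]_d R zcomb zcomb_is_additive.

Fact zcoords_is_additive : zmod_morphism zcoords.
Proof. exact: can2_zmod_morphism zcombK zcoordsK. Qed.
HB.instance Definition _ :=
  GRing.isZmodMorphism.Build R 'rV[int]_d zcoords zcoords_is_additive.

Lemma zcoords_basis i : zcoords (tnth e i) = delta_mx 0 i.
Proof.
rewrite -[RHS]zcombK; congr zcoords; rewrite /zcomb (bigD1 i) //= big1.
  by rewrite addr0 mxE !eqxx.
by move=> j ji; rewrite mxE (negPf ji) andbF.
Qed.

(** The regular representation of R, acting on the right of coordinate rows. *)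
Definition mulmat (r : R) : 'M[int]_d :=
  \matrix_(i, j) zcoords (tnth e i * r) 0 j.

Lemma zcoordsM s r : zcoords (s * r) = zcoords s *m mulmat r.
Proof.
rewrite -{1}[s]zcoordsK mulr_suml raddf_sum /=; apply/rowP=> j.
rewrite summxE !mxE; apply: eq_bigr => i _.
by rewrite mulrzAl raddfMz -scaler_int !mxE intz.
Qed.

Lemma row_mulmat i r : row i (mulmat r) = zcoords (tnth e i * r).
Proof. by apply/rowP=> j; rewrite !mxE. Qed.

Fact mulmat_is_additive : zmod_morphism mulmat.
Proof. by move=> r s; apply/matrixP=> i j; rewrite !mxE mulrBr raddfB !mxE. Qed.
HB.instance Definition _ :=
  GRing.isZmodMorphism.Build R 'M[int]_d mulmat mulmat_is_additive.

Lemma mulmatM r s : mulmat (r * s) = mulmat r *m mulmat s.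
Proof.
by apply/row_matrixP=> i; rewrite row_mul !row_mulmat mulrA zcoordsM.
Qed.

Lemma mulmat1 : mulmat 1 = 1%:M.
Proof.
by apply/row_matrixP=> i; rewrite row_mulmat mulr1 zcoords_basis row1.
Qed.

Lemma mulmatX r k : mulmat (r ^+ k) = mulmat r ^+ k.
Proof. by elim: k => [|k IHk]; rewrite ?mulmat1 // !exprS mulmatM IHk. Qed.

Definition trace_form : 'M[int]_d :=
  \matrix_(i, j) \tr (mulmat (tnth e i * tnth e j)).

Lemma trace_formE r s :
  (zcoords r *m trace_form *m (zcoords s)^T) 0 0 = \tr (mulmat (r * s)).
Proof.
rewrite -{2}[r]zcoordsK -{2}[s]zcoordsK /zcomb mulr_sumr !raddf_sum /= mxE.
apply: eq_bigr => j _; rewrite !mxE mulr_suml mulr_suml !raddf_sum /=.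
apply: eq_bigr => i _; rewrite !mxE mulrzAl mulrzAr !raddfMz /=.
by rewrite !mulrzz; ring.
Qed.

(** * Frobenius and the trace form modulo p *)

Section ModP.
Variable p : nat.
Hypothesis p_pr : prime p.

(** The p-th power map is additive only modulo p, so this matrix represents it only after
    reduction. *)
Definition frobmat : 'M[int]_d := \matrix_(i, j) zcoords (tnth e i ^+ p) 0 j.

Section Reduction.
Variable F : fieldType.
Hypothesis pF : p \in [pchar F].

(** The field is any of characteristic p, to serve both for F_p and for its extension of degree
    m. *)
Definition red m n (A : 'M[int]_(m, n)) : 'M[F]_(m, n) := map_mx intr A.

Lemma intr_eq0_pchar (z : int) : (z%:~R == 0 :> F) = (p%:Z %| z)%Z.
Proof. by rewrite (dvdz_pcharf pF). Qed.

Lemma intr_expp (z : int) : (z%:~R : F) ^+ p = z%:~R.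
Proof. exact: (rmorph_int (pFrobenius_aut pF)). Qed.

Lemma red_unit n (A : 'M[int]_n) : (red A \in unitmx) = ~~ (p%:Z %| \det A)%Z.
Proof. by rewrite unitmxE det_map_mx unitfE intr_eq0_pchar. Qed.

Lemma red_eqmod_zcoords r s :
  eqmod p r s <-> red (zcoords r) = red (zcoords s).
Proof.
split=> [[b rs] | rs].
  apply/eqP; rewrite -subr_eq0 -map_mxB -raddfB rs; apply/eqP/rowP=> j.
  by rewrite mulr_natl raddfMn !mxE mulmxnE raddfMn /= mulrn_pchar.
pose w := zcoords r - zcoords s.
have p_dvd j : (p%:Z %| w ord0 j)%Z.
  have /rowP/(_ j) := rs; rewrite -intr_eq0_pchar !mxE => /eqP.
  by rewrite rmorphB /= subr_eq0.
exists (zcomb (\row_j (w ord0 j %/ p%:Z)%Z)).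
rewrite mulr_natl -raddfMn -[LHS]zcoordsK raddfB; congr zcomb; apply/rowP=> j.
rewrite -[LHS]/(w ord0 j) -[LHS](divzK (p_dvd j)) mulmxnE [in RHS]mxE.
by rewrite -mulr_natr natz.
Qed.

Lemma red_eqmod_mulmat r s : eqmod p r s -> red (mulmat r) = red (mulmat s).
Proof.
case=> b rs; apply/eqP; rewrite -subr_eq0 -map_mxB -raddfB rs.
apply/eqP/matrixP=> i j.
by rewrite mulr_natl raddfMn !mxE mulmxnE raddfMn /= mulrn_pchar.
Qed.

(** The p-th power of the sum of c_i e_i is congruent to the sum of c_i^p e_i^p, and c_i^p = c_i in
    F by Fermat. *)
Lemma red_frobmat r : red (zcoords (r ^+ p)) = red (zcoords r) *m red frobmat.
Proof.
have /red_eqmod_zcoords -> : eqmod p (r ^+ p)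
    (\sum_i tnth e i ^+ p *~ (zcoords r 0 i ^+ p)).
  rewrite -{1}[r]zcoordsK; apply: eqmod_trans (eqmod_exprDn _ p_pr) _.
  apply: eqmod_sum => i _; rewrite -mulrzr exprMn -rmorphXn /= mulrzr.
  exact: eqmod_refl.
apply/rowP=> j; rewrite raddf_sum !mxE summxE rmorph_sum /=.
apply: eq_bigr => i _; rewrite raddfMz -scaler_int !mxE intz rmorphM rmorphXn /=.
by rewrite intr_expp.
Qed.

(* The trace form is invariant under Frobenius: tr(x^p y^p) = tr(xy)^p = tr(xy)
   modulo p. *)
Lemma red_trace_form :
  red frobmat *m red trace_form *m (red frobmat)^T = red trace_form.
Proof.
rewrite matrix.map_trmx -!map_mxM; apply/matrixP=> i j; rewrite [LHS]mxE [RHS]mxE.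
have -> : (frobmat *m trace_form *m frobmat^T) i j
    = \tr (mulmat ((tnth e i * tnth e j) ^+ p)).
  have rowF k : row k frobmat = zcoords (tnth e k ^+ p).
    by apply/rowP=> l; rewrite !mxE.
  rewrite exprMn -trace_formE -!rowF tr_row -row_mul mxE [RHS]mxE.
  by apply: eq_bigr => k _; rewrite [row _ _ _ _]mxE [col _ _ _ _]mxE.
rewrite mulmatX [trace_form i j]mxE -[RHS]intr_expp -rmorphXn /=.
apply/eqP; rewrite -subr_eq0 -rmorphB /= intr_eq0_pchar.
have [b ->] := tr_expr_prime (mulmat (tnth e i * tnth e j)) p_pr.
by rewrite dvdz_mulr // natz.
Qed.

End Reduction.

Lemma power_mod_frobmat :
  (forall r : R, power_mod p r) <-> ~~ (p%:Z %| \det frobmat)%Z.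
Proof.
have pF := pchar_Fp p_pr; split=> [pow | p_det].
  rewrite -(red_unit pF).
  have /fin_all_exists[a aP] i : exists a, eqmod p (tnth e i) (a ^+ p).
    exact: pow.
  (* The coordinates of p-th roots of the e_i modulo p form a left inverse of the Frobenius
     matrix. *)
  have: (\matrix_i red 'F_p (zcoords (a i))) *m red 'F_p frobmat = 1%:M.
    apply/row_matrixP=> i; rewrite row_mul rowK -red_frobmat //.
    have /(red_eqmod_zcoords pF) <- := aP i.
    by rewrite zcoords_basis /red map_delta_mx row1.
  by case/mulmx1_unit.
move=> r.
have /coprimezP[[u v] /= uv] : coprimez p%:Z (\det frobmat).
  by rewrite coprimezE prime_coprime // -dvdzE.
(* [v] inverts the determinant modulo p, so [v] times the adjugate inverts [frobmat]. *)
exists (zcomb (v *: zcoords r *m \adj frobmat)).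
apply/(red_eqmod_zcoords pF); rewrite red_frobmat // zcombK -map_mxM.
rewrite -mulmxA mul_adj_mx mul_mx_scalar scalerA /red.
apply/rowP=> j; rewrite !mxE rmorphM /=.
suff -> : (\det frobmat * v)%:~R = 1 :> 'F_p by rewrite mul1r.
have -> : \det frobmat * v = 1 - u * p%:Z by rewrite -uv; ring.
by rewrite rmorphB rmorphM /= -pmulrn pchar_Fp_0 // mulr0 subr0.
Qed.

Lemma frobmat_trace_form :
  (~~ (p%:Z %| \det frobmat)%Z) = (~~ (p%:Z %| \det trace_form)%Z).
Proof.
have pF := pchar_Fp p_pr; apply/idP/idP => [frob_unit | ]; last first.
  rewrite -!(red_unit pF) !unitmxE !unitfE => det_trace.
  (* By determinants in Phi T Phi^T = T, det Phi = 0 would force det T = 0. *)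
  have /(congr1 determinant) := red_trace_form pF.
  rewrite !det_mulmx; apply: contra_eq_neq => ->; rewrite !mul0r.
  by rewrite eq_sym.
have [m m_gt0 frobX] : exists2 m, (0 < m)%N & red 'F_p frobmat ^+ m = 1%:M.
  by apply: unitmx_finite_order; rewrite red_unit.
have powX (r : R) : eqmod p (r ^+ (p ^ m)) r.
  apply/(red_eqmod_zcoords pF).
  have -> k : red 'F_p (zcoords (r ^+ (p ^ k)))
            = red 'F_p (zcoords r) *m red 'F_p frobmat ^+ k.
    elim: k => [|k IHk]; first by rewrite expr1 mulmx1.
    by rewrite expnSr exprM red_frobmat // IHk exprSr mulmxA.
  by rewrite frobX mulmx1.
have [F pcharF cardF] := pPrimePowerField p_pr m_gt0.
rewrite -(red_unit pcharF).
have -> : red F trace_form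
    = \matrix_(i, j) \tr (red F (mulmat (tnth e i)) *m red F (mulmat (tnth e j))).
  apply/matrixP=> i j; rewrite !mxE -map_mxM -mulmatM /red.
  by rewrite -trace_map_mx.
apply: trace_form_unit => [i j | i | c c0].
- by rewrite -!map_mxM -!mulmatM mulrC.
- have mapX (M : 'M[int]_d) k : red F (M ^+ k) = red F M ^+ k.
    elim: k => [|k IHk]; first by rewrite /red map_mx1.
    by rewrite !exprS -IHk; exact: map_mxM.
  by rewrite cardF -mapX -mulmatX; apply: (red_eqmod_mulmat pcharF).
(* Applied to the coordinates of 1, the combination of multiplications by the e_i returns [c]
   itself. *)
have := congr1 (mulmx (red F (zcoords 1))) c0.
rewrite mulmx0 mulmx_sumr => {}c0; rewrite -{}c0.
rewrite [LHS]row_sum_delta; apply: eq_bigr => i _.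
rewrite -scalemxAr -map_mxM -zcoordsM mul1r zcoords_basis.
by rewrite map_delta_mx.
Qed.

End ModP.
End OrderBasis.

(** * The discriminant of an order as an integer determinant *)

Import passmx.

Lemma rat_row_denominator n (v : 'rV[rat]_n) :
  exists N : int, exists2 w : 'rV[int]_n,
    N != 0 & N%:~R *: v = map_mx intr w.
Proof.
exists (\prod_i denq (v 0 i)).
exists (\row_i (numq (v 0 i) * \prod_(j | j != i) denq (v 0 j))).
  by apply/prodf_neq0 => i _; exact: denq_neq0.
apply/rowP=> i; rewrite !mxE (bigD1 i) //= !rmorphM /= numqE; ring.
Qed.

Section OrderDiscriminant.
Variables (R : comPzRingType) (K : fieldExtType rat) (iota : {rmorphism R -> K}).
Hypothesis iota_inj : injective iota.
Variable e : (degree K).-tuple R.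
Hypothesis e_basis : Zbasis e.

Let b : (degree K).-tuple K := vbasis {:K}.
Let b_basis : basis_of {:K} b. Proof. exact: vbasisP. Qed.

Let E : 'M[rat]_(degree K) :=
  \matrix_(i, j) rVof b (iota (tnth e i)) 0 j.

Let rVof_zcomb v :
  rVof b (iota (zcomb e v)) = map_mx intr v *m E.
Proof.
rewrite /zcomb !raddf_sum /=; apply/rowP=> j; rewrite summxE mxE.
by apply: eq_bigr => i _; rewrite !raddfMz -scaler_int !mxE.
Qed.

(** A rational relation between the rows, cleared of denominators, is an integer relation between
    the e_i because [iota] is injective, and it is trivial. *)
Let E_unit : E \in unitmx.
Proof.
rewrite -row_free_unit; apply/inj_row_free => v vE.
have [N [w N0 Nv]] := rat_row_denominator v.
have: rVof b (iota (zcomb e w)) == 0.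
  by rewrite rVof_zcomb -Nv -scalemxAl vE scaler0.
rewrite rVof_eq0 // -(rmorph0 iota) (inj_eq iota_inj) => /eqP w0.
have: w = 0 by rewrite -(zcombK e_basis w) w0 raddf0.
move=> w00; move/eqP: Nv; rewrite w00 map_mx0 scaler_eq0 intr_eq0 (negPf N0).
by move/eqP.
Qed.

(** [E] changes coordinates from [e] to the chosen basis of K, so the two multiplication matrices
    are similar over the rationals. *)
Lemma field_trace_mulmat r :
  field_trace (iota r) = (\tr (mulmat e_basis r))%:~R.
Proof.
rewrite /field_trace -/b; set M := mxof _ _ _.
have EM : E *m M = map_mx intr (mulmat e_basis r) *m E.
  apply/row_matrixP=> i; rewrite !row_mul.
  have rowE k : row k E = rVof b (iota (tnth e k)).
    by apply/rowP=> j; rewrite !mxE.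
  rewrite rowE -rVof_app // lfunE /= -rmorphM.
  rewrite mulrC -[tnth e i * r](zcoordsK e_basis) rVof_zcomb -row_mulmat.
  by rewrite map_row.
have -> : M = invmx E *m (map_mx intr (mulmat e_basis r) *m E).
  by rewrite -EM mulKmx.
by rewrite mxtrace_mulC -mulmxA mulmxV // mulmx1 trace_map_mx.
Qed.

Lemma disc_trace_form : disc iota e = \det (trace_form e_basis).
Proof.
rewrite /disc.
have -> : \matrix_(i, j) field_trace (iota (tnth e i) * iota (tnth e j))
    = map_mx intr (trace_form e_basis) :> 'M[rat]__.
  by apply/matrixP=> i j; rewrite !mxE -rmorphM field_trace_mulmat.
by rewrite det_map_mx numq_int.
Qed.

End OrderDiscriminant.

(** * The equivalences, for any ring and for orders *)

(* The pair (1, 13) is excluded because the equivalences fail there: in the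
   field with 27 elements, every element is a 13th power modulo 13 R = R, but
   the sums of 13th powers form the prime field. *)
Theorem theorem1p3 (n p : nat) (n_gt0 : (0 < n)%N) (hp : p = 11%N \/ p = 13%N)
    (hnp : (n, p) <> (1, 13)%N) (R : comPzRingType) :
  [/\ (forall M : 'M[R]_n, sum_of_powers p M) <->
        (forall r : R, power_mod p r),
      forall (K : fieldExtType rat) (iota : {rmorphism R -> K}),
        is_order iota ->
        forall e : (degree K).-tuple R, Zbasis e ->
        (((forall M : 'M[R]_n, sum_of_powers p M) <->
            coprimez p%:Z (disc iota e)) /\
         ((forall r : R, power_mod p r) <-> coprimez p%:Z (disc iota e)))
    & forall M : 'M[R]_n, power_mod p (\tr M) <-> sum_of_powers p M].
Proof.
have p_pr : prime p by case: hp => ->.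
have tr_iff (M : 'M[R]_n) : power_mod p (\tr M) <-> sum_of_powers p M.
  exact: sum_of_powers_power_mod.
have mx_iff : (forall M : 'M[R]_n, sum_of_powers p M) <->
              (forall r : R, power_mod p r).
  split=> [sums r | pow M]; last exact/tr_iff.
  (* A matrix of trace [r] transfers the hypothesis to [r]. *)
  have /tr_iff := sums (r *: delta_mx (Ordinal n_gt0) (Ordinal n_gt0)).
  by rewrite mxtraceZ mxtrace_delta eqxx mulr1.
split=> // K iota [iota_inj _] e e_basis.
have pow_iff : (forall r : R, power_mod p r) <-> coprimez p%:Z (disc iota e).
  rewrite (disc_trace_form iota_inj e_basis) coprimezE prime_coprime //.
  rewrite -[(p %| _)%N]/(p%:Z %| _)%Z -frobmat_trace_form //.
  exact: power_mod_frobmat.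
by split=> //; apply: iff_trans mx_iff pow_iff.
Qed.
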